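(* For every sequence $(a_n)_{n\ge 1}$ with $a_n\ge 0$ for all $n$, $$\sum_{n=1}^{\infty}\Big(\frac{1}{n}\sum_{k=n}^{\infty}a_k\Big)^{1/2}\ \ge\ 0.9\sum_{n=1}^{\infty}a_n^{1/2} .$$
   Context: All sums have nonnegative terms and take values in $[0,+\infty]$, with $(+\infty)^{1/2}=+\infty$. *)

(* Defs.v *)
From mathcomp Require Export all_boot all_order all_algebra.
From mathcomp Require Export all_classical all_reals all_analysis.

(* Main.v *)
Require Import Defs.
From mathcomp Require Import ring lra.
Import Order.TTheory GRing.Theory Num.Theory.
Import numFieldNormedType.Exports.
Local Open Scope classical_set_scope.
Local Open Scope ring_scope.
Local Open Scope ereal_scope.

(** Write [A n] for the tail sum from [n] on, [q n] for [sqrt (A n / n)] and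
    [c] for [9/10].  Given weights [w n >= 0] with [w 1 = 0] and
    [c^2 + (w n.+1)^2 / (n + 1) <= (w n + 1)^2 / n],
    Cauchy-Schwarz applied to [A n = a n + A n.+1] yields
    [c * sqrt (a n) + w n.+1 * q n.+1 <= (1 + w n) * q n];
    these inequalities telescope, so the partial sums of [c * sqrt (a n)] are
    at most those of [q n]. *)

(* For linear weights [w n = b * n - 1/2] the weight inequality reduces to
   [b^2 - 2 * b + c^2 <= 0], that is [b >= 1 - sqrt (1 - c^2) = 0.5641...].
   Such a weight is positive at [n = 1], so the first two weights are chosen
   separately. *)
Definition weight {R : realType} (n : nat) : R :=
  if n == 1%N then 0%R else if n == 2%N then (61 / 100)%R
  else (113 / 200 * n%:R - 1 / 2)%R.

Section weighted_telescoping.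
Local Open Scope ring_scope.
Context {R : realType}.

Lemma weight_ge0 (n : nat) : (0 < n)%N -> 0 <= weight n :> R.
Proof.
rewrite /weight => n_gt0; case: ifP => // _; case: ifP => [_|_]; first by lra.
have : 1 <= n%:R :> R by rewrite ler1n.
by lra.
Qed.

Lemma weight_step (n : nat) : (0 < n)%N ->
  (9 / 10) ^+ 2 + weight n.+1 ^+ 2 / n.+1%:R <= (weight n + 1) ^+ 2 / n%:R :> R.
Proof.
case: n => [//|[|[|n]]] _; rewrite /weight /=; [by lra | by lra |].
have n_ge0 : 0 <= n%:R :> R by [].
have -> : n.+3%:R = n%:R + 3 :> R by rewrite -addn3 natrD.
have -> : n.+4%:R = n%:R + 4 :> R by rewrite -addn4 natrD.
move: (n%:R : R) n_ge0 => x x_ge0.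
have x3 : x + 3 != 0 by apply/negP => /eqP; lra.
have x4 : x + 4 != 0 by apply/negP => /eqP; lra.
rewrite -subr_ge0.
(* With [b = 113/200], [c = 9/10] and [n = x + 3], the constant is [2 * b - b^2 - c^2]; the other
   term is [1/4 * (1/n - 1/(n + 1))]. *)
rewrite (_ : _ - _ = 31 / 200 / 200 + 1 / (4 * ((x + 3) * (x + 4)))); last first.
  by field; rewrite x3 x4.
rewrite addr_ge0 ?divr_ge0 ?mulr_ge0 ?addr_ge0 //; lra.
Qed.

(** Cauchy-Schwarz for the vectors [(c, w' / sqrt m')] and [(x, sqrt m' * y)], whose squared norms
    are controlled by the two last hypotheses. *)
Lemma weighted_cauchy_schwarz (c w w' m m' x y z : R) :
  0 < m -> 0 < m' -> 0 <= w -> 0 <= z ->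
  c ^+ 2 + w' ^+ 2 / m' <= (w + 1) ^+ 2 / m ->
  m * z ^+ 2 = x ^+ 2 + m' * y ^+ 2 ->
  c * x + w' * y <= z + w * z.
Proof.
move=> m_gt0 m'_gt0 w_ge0 z_ge0 hw hz.
have h : (c * x + w' * y) ^+ 2 <= ((w + 1) * z) ^+ 2.
  have -> : ((w + 1) * z) ^+ 2 = (w + 1) ^+ 2 / m * (x ^+ 2 + m' * y ^+ 2).
    by rewrite -hz; field; rewrite gt_eqF.
  have s_ge0 : 0 <= x ^+ 2 + m' * y ^+ 2.
    by rewrite addr_ge0 ?sqr_ge0 // mulr_ge0 ?sqr_ge0 // ltW.
  apply: le_trans (ler_wpM2r s_ge0 hw); rewrite -subr_ge0.
  (* Lagrange's identity: the Cauchy-Schwarz defect is a square over [m']. *)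
  have -> : (c ^+ 2 + w' ^+ 2 / m') * (x ^+ 2 + m' * y ^+ 2)
      - (c * x + w' * y) ^+ 2 = (c * m' * y - w' * x) ^+ 2 / m'.
    by field; rewrite gt_eqF.
  by rewrite divr_ge0 ?sqr_ge0 // ltW.
have -> : z + w * z = (w + 1) * z by ring.
have wz_ge0 : 0 <= (w + 1) * z by rewrite mulr_ge0 // addr_ge0.
by rewrite leNgt; apply/negP => hlt; nra.
Qed.

Lemma tail_partial_sum_le (a r : nat -> R) (N : nat) :
  (forall n, (0 < n)%N -> 0 <= a n) -> (forall n, (0 < n)%N -> 0 <= r n) ->
  (forall n, (0 < n)%N -> r n = a n + r n.+1) ->
  \sum_(1 <= n < N) (9 / 10 * Num.sqrt (a n)) <=
  \sum_(1 <= n < N) Num.sqrt (n%:R^-1 * r n).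
Proof.
move=> a_ge0 r_ge0 rE; case: N => [|N]; first by rewrite !big_geq.
(* The induction needs the boundary term left over by telescoping; it is nonnegative, and at [N = 0]
   it vanishes because [weight 1 = 0]. *)
suff : \sum_(1 <= n < N.+1) (9 / 10 * Num.sqrt (a n))
    + weight N.+1 * Num.sqrt (N.+1%:R^-1 * r N.+1)
    <= \sum_(1 <= n < N.+1) Num.sqrt (n%:R^-1 * r n).
  by apply: le_trans; rewrite lerDl mulr_ge0 ?weight_ge0 ?sqrtr_ge0.
elim: N => [|N IH]; first by rewrite !big_geq // /weight /= mul0r addr0.
rewrite !(big_nat_recr N.+1) //=.
set S := \sum_(1 <= n < N.+1) _ in IH *.
set T := \sum_(1 <= n < N.+1) _ in IH *.
suff : 9 / 10 * Num.sqrt (a N.+1)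
    + weight N.+2 * Num.sqrt (N.+2%:R^-1 * r N.+2)
    <= Num.sqrt (N.+1%:R^-1 * r N.+1)
       + weight N.+1 * Num.sqrt (N.+1%:R^-1 * r N.+1).
  by move: IH; lra.
apply: (@weighted_cauchy_schwarz _ _ _ N.+1%:R N.+2%:R) => //.
- exact: weight_ge0.
- exact: weight_step.
rewrite !sqr_sqrtr ?a_ge0 ?mulr_ge0 ?invr_ge0 ?r_ge0 //.
by rewrite !mulrA !mulfV ?pnatr_eq0 // !mul1r rE.
Qed.

End weighted_telescoping.

Theorem theorem1p5 (R : realType) (a : nat -> R)
    (a_ge0 : forall n : nat, (1 <= n)%N -> (0 <= a n)%R) :
  \sum_(1 <= n <oo) sqrte ((n%:R^-1)%:E * \sum_(n <= k <oo) (a k)%:E) >=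
  (9 / 10)%:E * \sum_(1 <= n <oo) sqrte (a n)%:E.
Proof.
pose A n := \sum_(n <= k <oo) (a k)%:E.
have A_ge0 n : (0 < n)%N -> 0 <= A n.
  by move=> n0; apply: nneseries_ge0 => k nk _; rewrite lee_fin a_ge0 // (leq_trans n0).
have A_rec n : (0 < n)%N -> A n = (a n)%:E + A n.+1.
  move=> n0; rewrite /A (nneseries_split n 1) ?addn1 ?big_nat1 // => k nk.
  by rewrite lee_fin a_ge0 // (leq_trans n0).
set q := fun n : nat => sqrte ((n%:R^-1)%:E * A n).
have q_ge0 n : (1 <= n)%N -> true -> 0 <= q n by move=> _ _; exact: sqrte_ge0.
(* If [A 1] is infinite, the term [q 1] alone makes the larger side infinite. Otherwise every tail
   is finite and the real-valued lemma applies. *)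
have [A1y|A1_fin] := eqVneq (A 1%N) +oo.
  rewrite (_ : \sum_(1 <= n <oo) q n = +oo) ?leey //.
  apply/eqP; rewrite -leye_eq.
  apply: le_trans (nneseries_lim_ge 2 q_ge0).
  by rewrite big_nat1 /q A1y invr1 mul1e.
have A_fin n : (0 < n)%N -> A n \is a fin_num.
  elim: n => [//|[|n] IH] _.
    by rewrite ge0_fin_numE ?A_ge0 // ltey.
  by move: (IH isT); rewrite A_rec // fin_numD => /andP[].
pose r n := fine (A n).
have AE n : (0 < n)%N -> A n = (r n)%:E by move=> n0; rewrite fineK // A_fin.
have cvg_sqrta : cvgn (fun N => \sum_(1 <= n < N) sqrte (a n)%:E).
  by apply: is_cvg_nneseries => n _ _; exact: sqrte_ge0.
(* It suffices to bound each partial sum of the [sqrt (a n)] series, scaled by [9/10], by the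
   partial sum of [q] of the same length. *)
rewrite -limeMl //; apply: lime_le; first exact: is_cvgeZl.
apply: nearW => N; apply: le_trans (nneseries_lim_ge N q_ge0).
rewrite ge0_sume_distrr; last by move=> n _; exact: sqrte_ge0.
rewrite [leRHS](_ : _ = \sum_(1 <= n < N) (Num.sqrt (n%:R^-1 * r n))%:E); last first.
  by apply: eq_big_nat => n /andP[n0 _]; rewrite /q AE.
under eq_bigr do rewrite /= -EFinM.
rewrite !sumEFin lee_fin; apply: tail_partial_sum_le => // n n0.
- by rewrite fine_ge0 // A_ge0.
- by apply: EFin_inj; rewrite EFinD -!AE // A_rec.
Qed.
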